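(* Let $G$ be a bipartite matching covered graph and $M$ a perfect matching of $G$. Then $\mathrm{pmw}(G)\le \mathrm{cycw}(D(G,M))\le 2\,\mathrm{pmw}(G)$.
   Context: Graphs are finite without multiple edges. A graph is matching covered if it is connected and every edge lies in some perfect matching. For $X\subseteq V(G)$, $\partial(X)$ is the set of edges (arcs, in a digraph) with exactly one endpoint in $X$. Matching porosity: $\mathrm{mp}(\partial(X))=\max_{M'}|M'\cap\partial(X)|$ over perfect matchings $M'$ of $G$. A perfect matching decomposition of $G$ is $(T,\delta)$ with $T$ a cubic tree (non-leaf vertices of degree $3$) and $\delta$ a bijection from the leaves of $T$ to $V(G)$; for $e\in E(T)$, $\partial(e)$ is the cut whose shore is the $\delta$-image of the leaves of one component of $T-e$. Its width is $\max_e\mathrm{mp}(\partial(e))$; $\mathrm{pmw}(G)$ is the minimum width. For bipartite $G=(A\cup B,E)$ with perfect matching $M=\{a_1b_1,\dots,a_mb_m\}$, $a_i\in A,b_i\in B$, the $M$-direction $D(G,M)$ has vertices $v_1,\dots,v_m$ and arcs $(v_i,v_j)$, $i\ne j$, whenever $a_ib_j\in E$. A cycle decomposition of a digraph $D$ is $(T,\varphi)$ with $T$ a cubic tree and $\varphi$ a bijection from leaves of $T$ to $V(D)$; for $e\in E(T)$, $\partial(e)$ is defined analogously, and its cycle porosity is the maximum over families $\mathcal{C}$ of pairwise vertex-disjoint directed cycles of $D$ of $|\partial(e)\cap\bigcup_{C\in\mathcal{C}}E(C)|$. Width is the maximum cycle porosity over tree edges; $\mathrm{cycw}(D)$ is the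 minimum width. *)

(* Defs.v *)
From HB Require Import structures.
From mathcomp Require Import all_boot.
From Stdlib Require Import Classical.

Set Implicit Arguments.
Unset Strict Implicit.
Unset Printing Implicit Defensive.

Record sgraph := SGraph {
  svertex :> finType;
  sedge : rel svertex;
  sedge_sym : symmetric sedge;
  sedge_irr : irreflexive sedge }.

Notation "x -- y" := (sedge x y) (at level 30).

Record digraph := DiGraph {
  dvertex :> finType;
  arc : rel dvertex;
  arc_irr : irreflexive arc }.

Section Graphs.
Variable G : sgraph.
Implicit Types (x y : G) (A B X : {set G}) (M : {set {set G}}).

Definition edge_set : {set {set G}} :=
  [set [set p.1; p.2] | p in [set p : G * G | p.1 -- p.2]].

Definition degree x : nat := #|[set y | x -- y]|.

Definition connected : Prop :=
  0 < #|G| /\ forall x y, connect (@sedge G) x y.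

Definition cut X : {set {set G}} := [set e in edge_set | #|e :&: X| == 1].

Definition perfect_matching M : bool :=
  (M \subset edge_set) && [forall x, #|[set e in M | x \in e]| == 1].

Definition matching_covered : Prop :=
  connected /\
  forall e, e \in edge_set -> exists2 M, perfect_matching M & e \in M.

Definition matching_porosity X : nat :=
  \max_(M : {set {set G}} | perfect_matching M) #|M :&: cut X|.

Definition bipartition A B : Prop :=
  [/\ A :|: B = setT, [disjoint A & B]
    & forall x y, x -- y ->
        (x \in A) && (y \in B) || (x \in B) && (y \in A)].

(* A closed walk x -- y -- x satisfies [ucycle], hence the bound 3. *)
Definition acyclic : Prop :=
  forall c : seq G, ucycle (@sedge G) c -> size c < 3.

Definition tree : Prop := connected /\ acyclic.

Definition leaf x : bool := degree x == 1.

Definition cubic_tree : Prop :=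
  tree /\ forall x, ~~ leaf x -> degree x = 3.

Definition del_edge (s t : G) : rel G :=
  fun x y => (x -- y) && ([set x; y] != [set s; t]).

End Graphs.

Section MDirection.
Variables (G : sgraph) (A B : {set G}) (M : {set {set G}}).

(* The vertex v_i is represented by the i-th matching edge {a_i, b_i}. *)
Definition mdir_vertex := {e : {set G} | e \in M}.

Definition mdir_arc : rel mdir_vertex := fun e f =>
  (e != f) &&
  [exists a in val e :&: A, [exists b in val f :&: B, a -- b]].

Lemma mdir_arc_irr : irreflexive mdir_arc.
Proof. by move=> e; rewrite /mdir_arc eqxx. Qed.

Definition mdirection : digraph := DiGraph mdir_arc_irr.
End MDirection.

Section Digraphs.
Variable D : digraph.

Definition dcut (X : {set D}) : {set D * D} :=
  [set a | arc a.1 a.2 && ((a.1 \in X) != (a.2 \in X))].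

(* A directed cycle is given by the cyclic sequence of its (distinct)
   vertices, whose length is therefore at most #|D|. *)
Definition dicycle (c : seq D) : bool := (c != [::]) && ucycleb (@arc D) c.

Definition cycle_arcs (c : seq D) : {set D * D} :=
  [set (x, next c x) | x in c].

Definition disjoint_dicycles (C : {set #|D|.-bseq D}) : bool :=
  [forall c in C, dicycle c] &&
  [forall c in C, [forall c' in C, (c != c') ==> [disjoint c & c']]].

Definition cycle_porosity (X : {set D}) : nat :=
  \max_(C : {set #|D|.-bseq D} | disjoint_dicycles C)
    #|dcut X :&: \bigcup_(c in C) cycle_arcs c|.
End Digraphs.

Section Decompositions.
Variable V : finType.

Definition leaf_of (T : sgraph) := {t : T | leaf t}.

Definition decomposition (T : sgraph) (d : leaf_of T -> V) : Prop :=
  cubic_tree T /\ bijective d.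

(* For an edge st of T: the image of the leaves in the component of T - st
   that contains s.  The component of t yields the complementary shore. *)
Definition shore (T : sgraph) (d : leaf_of T -> V) (s t : T) : {set V} :=
  [set d l | l : leaf_of T & connect (del_edge s t) s (val l)].

Variable porosity : {set V} -> nat.

Definition width (T : sgraph) (d : leaf_of T -> V) : nat :=
  \max_(p : T * T | p.1 -- p.2) porosity (shore d p.1 p.2).

Definition min_width (k : nat) : Prop :=
  (exists (T : sgraph) (d : leaf_of T -> V), decomposition d /\ width d = k) /\
  (forall (T : sgraph) (d : leaf_of T -> V), decomposition d -> k <= width d).
End Decompositions.

(* The widths are minima over trees of arbitrary size, hence stated as
   relations: [is_pmw G k] reads pmw(G) = k, and [is_cycw D k] reads
   cycw(D) = k.  By [min_width_ex] and [min_width_uniq] below they are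
   well defined as soon as there are two vertices; a cubic tree has at least
   two leaves, so cycw of a one-vertex digraph is undefined. *)
Definition is_pmw (G : sgraph) (k : nat) : Prop :=
  min_width (@matching_porosity G) k.

Definition is_cycw (D : digraph) (k : nat) : Prop :=
  min_width (@cycle_porosity D) k.

Lemma min_width_uniq (V : finType) (f : {set V} -> nat) k k' :
  min_width f k -> min_width f k' -> k = k'.
Proof.
move=> [[T [d [dd <-]]] min1] [[T' [d' [dd' <-]]] min2].
by apply/eqP; rewrite eqn_leq min1 // min2.
Qed.

Section Existence.

Lemma cubic_tree_K2 : exists2 T : sgraph, cubic_tree T & #|@leaf T| = 2.
Proof.
have es : symmetric (fun x y : bool => x != y) by case; case.
have ei : irreflexive (fun x y : bool => x != y) by case.
pose T := SGraph es ei.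
have deg (x : T) : degree x = 1.
  rewrite /degree (_ : [set y | x -- y] = [set ~~ x]) ?cards1 //.
  by apply/setP => y; rewrite !inE /=; case: x; case: y.
have lf (x : T) : leaf x by rewrite /leaf deg.
exists T; last first.
  by rewrite -card_bool; apply: eq_card => x; rewrite [RHS]inE; exact: lf.
split=> [|x]; last by rewrite lf.
split.
  split=> [|x y]; first by apply/card_gt0P; exists true.
  have [->|ne] := eqVneq x y; first exact: connect0.
  exact: connect1.
move=> c /andP[_ /card_uniqP <-].
by rewrite ltnS (leq_trans (max_card _)) // card_bool.
Qed.

Variables (T : sgraph) (l : T).

Definition split_edge (u v : T + bool) : bool :=
  match u, v with
  | inl x, inl y => x -- y
  | inl x, inr _ | inr _, inl x => x == l
  | inr _, inr _ => false
  end.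

Lemma split_edge_sym : symmetric split_edge.
Proof. by case=> x; case=> y //=; rewrite sedge_sym. Qed.

Lemma split_edge_irr : irreflexive split_edge.
Proof. by case=> x //=; rewrite sedge_irr. Qed.

Definition split_leaf : sgraph := SGraph split_edge_sym split_edge_irr.

Lemma split_degree_inl (x : T) :
  degree (inl x : split_leaf) = degree x + (x == l).*2.
Proof.
rewrite {1}/degree -sum1dep_card big_sumType /= sum1dep_card; congr (_ + _).
by rewrite sum1dep_card; case: eqVneq; rewrite ?cardsT ?card_bool // cards0.
Qed.

Lemma split_degree_inr b : degree (inr b : split_leaf) = 1.
Proof.
by rewrite /degree -!sum1dep_card big_sumType /= big_pred1_eq big_pred0.
Qed.

Lemma split_cubic : cubic_tree T -> leaf l ->
  cubic_tree split_leaf /\ #|@leaf split_leaf| = #|@leaf T|.+1.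
Proof.
move=> [[[T0 Tc] Ta] T3] ll; have dl := eqP ll.
have lfl x : leaf (inl x : split_leaf) = leaf x && (x != l).
  rewrite /leaf split_degree_inl; case: (eqVneq x l) => [->|_] /=.
    by rewrite dl.
  by rewrite addn0 andbT.
have lfr b : leaf (inr b : split_leaf) by rewrite /leaf split_degree_inr.
split; last first.
  rewrite -!sum1_card big_sumType /=.
  have -> : \sum_(i : bool | (inr i : split_leaf) \in @leaf split_leaf) 1 = 2.
    by rewrite (eq_bigl predT) ?sum1_card ?card_bool.
  rewrite [in RHS](bigD1 l) //= addn2; congr (_.+2).
  by apply: eq_bigl => x; exact: lfl.
split; last first.
  case=> [x|b]; last by rewrite lfr.
  rewrite lfl split_degree_inl; case: (eqVneq x l) => [->|_] /=; first by rewrite dl.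
  by rewrite andbT addn0 => /T3.
have symc : connect_sym (@sedge split_leaf).
  exact: sym_connect_sym (@sedge_sym split_leaf).
have toL u : connect (@sedge split_leaf) (inl l) u.
  case: u => [x|b]; last by apply: connect1 => /=; rewrite eqxx.
  have /connectP[p pp ->] := Tc l x.
  elim: p (l) pp => [|y p IH] z /=; first by rewrite connect0.
  by case/andP=> zy /IH; apply: connect_trans; apply: connect1.
split.
  split=> [|u v]; first by apply/card_gt0P; exists (inl l).
  by apply: connect_trans (toL v); rewrite symc.
move=> c uc; have [/existsP[b bc]|] :=
  boolP [exists b, (inr b : split_leaf) \in c].
  have [i p def_c] := rot_to bc.
  rewrite -(size_rot i) def_c.
  have {uc} : ucycle split_edge (inr b :: p) by rewrite -def_c rot_ucycle.
  case: p {def_c} => [|[x|y] p] // /andP[/=] //.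
  case/andP=> /eqP->; case/lastP: p => [//|p u].
  rewrite rcons_path => /andP[_]; rewrite last_rcons.
  case: u => [y|//] /eqP-> /andP[_ /andP[]].
  by rewrite mem_rcons inE eqxx.
rewrite negb_exists => /forallP nob.
pose c' : seq T :=
  pmap (fun u : T + bool => if u is inl x then Some x else None) c.
have def_c : c = map inl c'.
  rewrite /c'; elim: c nob {uc c'} => //= u c IH nob.
  case: u nob => [x|b] nob; last by have := nob b; rewrite inE eqxx.
  by congr (_ :: _); apply: IH => b; have := nob b; rewrite inE.
rewrite def_c size_map; apply: Ta; move: uc; rewrite def_c.
case/andP=> cyc un; apply/andP; split; last first.
  by move: un; rewrite map_inj_uniq // => ? ? [].
by move: cyc; rewrite cycle_map.
Qed.
End Existence.

Lemma cubic_tree_ex n :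
  exists2 T : sgraph, cubic_tree T & #|@leaf T| = n.+2.
Proof.
elim: n => [|n [T Tc Tn]]; first exact: cubic_tree_K2.
have /card_gt0P[l ll] : 0 < #|@leaf T| by rewrite Tn.
have [? E] := split_cubic Tc ll.
by exists (split_leaf l); rewrite ?E ?Tn.
Qed.

Lemma min_width_ex (V : finType) (f : {set V} -> nat) :
  1 < #|V| -> exists k, min_width f k.
Proof.
move=> V2; have [T Tc Tn] := cubic_tree_ex #|V|.-2.
have [d dd] : exists d : leaf_of T -> V, decomposition d.
  have eqV : #|{: leaf_of T}| = #|V|.
    by rewrite card_sig Tn; case: #|V| V2 => [|[]].
  exists (fun x => enum_val (cast_ord eqV (enum_rank x))); split=> //.
  exists (fun v => enum_val (cast_ord (esym eqV) (enum_rank v))).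
    by move=> x; rewrite enum_valK cast_ordK enum_rankK.
  by move=> v; rewrite enum_valK cast_ordKV enum_rankK.
have [m lem] := ubnP (width f d).
elim: m T d dd lem {Tc Tn} => // m IH T d dd lem.
have [|nex] := classic (exists (T' : sgraph) (d' : leaf_of T' -> V),
                          decomposition d' /\ width f d' < width f d).
  by case=> T' [d' [dd' lt]]; apply: IH dd' (leq_trans lt lem).
exists (width f d); split; first by exists T, d.
move=> T' d' dd'; rewrite leqNgt; apply/negP => lt.
by apply: nex; exists T', d'.
Qed.

(* Main.v *)
(* A cubic tree with labelled leaves amounts to a binary tree rooted at one of
   its edges, and a perfect matching of G to a permutation sigma of M fixing e
   or following an arc of D(G,M) at each e; the nontrivial cycles of sigma are
   disjoint dicycles, and every disjoint family arises so.  Hence the cycle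
   porosity of Y is the maximum number of e that sigma moves across Y.

   Splitting each leaf e of a cycle decomposition into the two ends of e turns
   a shore Y into a union of edges of M, which has the same porosity; the new
   shores are single vertices.  This gives pmw <= cycw.  Conversely, restricting
   a perfect matching decomposition to the leaves in A turns a shore X into
   Y = {e | the A-end of e is in X}; when sigma moves e across Y, either the
   edge of the matching from e to sigma e or the edge sigma e of M crosses X. *)
Require Import Defs.
From mathcomp Require Import all_boot.

Set Implicit Arguments.
Unset Strict Implicit.
Unset Printing Implicit Defensive.

(** * The two sides of a tree edge *)

Section TreeSides.
Variable T : sgraph.
Implicit Types (s t u x y : T).

Definition side s t : {set T} := [set x | connect (del_edge s t) s x].

Lemma del_edge_sym s t : symmetric (del_edge s t).
Proof. by move=> x y; rewrite /del_edge sedge_sym setUC. Qed.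

Lemma del_edgeC s t : del_edge s t =2 del_edge t s.
Proof. by move=> x y; rewrite /del_edge [[set s; t]]setUC. Qed.

Lemma mem_side s t : s \in side s t.
Proof. by rewrite inE connect0. Qed.

(** A path that avoids the edge [s -- t] never leaves [S], since no other edge does. Upper bounds on
    sides, notably in joined trees, come from this. *)
Lemma side_sub s t (S : {set T}) : s \in S ->
  (forall x y, x \in S -> y \notin S -> x -- y -> [set x; y] = [set s; t]) ->
  side s t \subset S.
Proof.
move=> sS cross; apply/subsetP => x; rewrite inE => /connectP[p pp ->].
suff h z : z \in S -> path (del_edge s t) z p -> last z p \in S by exact: h.
elim: p z {pp} => [//|y p IH] z /= zS /andP[/andP[zy ne] pp].
apply: IH pp; apply/negPn/negP => yS.
by case/negP: ne; apply/eqP/cross.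
Qed.

Lemma path_del_edge s t x p :
  path (@sedge T) x p -> s \notin x :: p -> path (del_edge s t) x p.
Proof.
elim: p x => [//|y p IH] x /= /andP[xy pp]; rewrite !inE !negb_or.
case/and3P=> sx sy sp; rewrite IH ?inE ?negb_or ?sy // andbT /del_edge xy /=.
apply/eqP => /setP/(_ s).
by rewrite !inE eqxx /= (negPf sx) (negPf sy).
Qed.

(** Closing a simple path from [s] to [t] that avoids the edge [s -- t] gives a cycle on at least
    three vertices, and opening such a cycle at its last edge gives back the path. *)
Lemma acyclicP : acyclic T <-> forall s t, s -- t -> t \notin side s t.
Proof.
split=> [ac s t st|br c].
  apply/negP; rewrite inE => /connectP[p0 pp0 def_t].
  move: def_t; case/shortenP: pp0 => p pp up _ def_t.
  have := ac (s :: p); rewrite /ucycle up andbT /cycle rcons_path -def_t.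
  rewrite sedge_sym st andbT (sub_path _ pp); last by move=> x y /andP[].
  (* An empty path would force [s = t], and a single step would be the deleted edge; any longer path
     closes to a forbidden cycle. *)
  case: p pp up def_t => [|x [|y p]] /=.
  - by move=> _ _ e; rewrite e sedge_irr in st.
  - by rewrite andbT => /andP[_ /eqP ne] _ e; rewrite e in ne.
  - by move=> _ _ _ /(_ isT).
case: c => [|s [|x [|y p]]] //; rewrite /ucycle /cycle rcons_path => /andP[].
set t := last s _ => /andP[pp ts] un.
have /negP[] := br _ _ (etrans (sedge_sym s t) ts).
rewrite inE; apply/connectP; exists [:: x, y & p] => //.
have [sx /andP[pxp up]] : s -- x /\ path (@sedge T) x (y :: p) && uniq (x :: y :: p).
  case/andP: pp => sx pxp; case/andP: un => _ up.
  by split=> //; apply/andP.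
have snp : s \notin [:: x, y & p] by case/andP: un.
suff: del_edge s t s x && path (del_edge s t) x (y :: p) by [].
rewrite path_del_edge // andbT /del_edge sx /=; apply/eqP => /setP/(_ x).
rewrite !inE eqxx orbT /=.
have -> : (x == s) = false.
  by apply/negP => /eqP e; rewrite -e inE eqxx in snp.
have tin : t \in y :: p by rewrite /t /= mem_last.
suff -> : (x == t) = false by [].
by apply/negP => /eqP e; rewrite e in up; rewrite /= tin in up.
Qed.

Hypothesis treeT : tree T.

Lemma bridge s t : s -- t -> t \notin side s t.
Proof. by move: s t; apply/acyclicP; case: treeT. Qed.

Lemma side_disj s t : s -- t -> [disjoint side s t & side t s].
Proof.
move=> st; apply/pred0P => x /=; apply/negP => /andP[]; rewrite !inE => sx tx.
have /negP[] := bridge st; rewrite inE; apply: connect_trans sx _.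
rewrite (sym_connect_sym (@del_edge_sym s t)).
by rewrite (eq_connect (del_edgeC s t)).
Qed.

(** On a simple path from [s] to [x] everything after the start misses [s], so it avoids the first
    edge [s -- u]. *)
Lemma side_step s x : x != s -> exists2 u, s -- u & x \in side u s.
Proof.
have [[_ con] _] := treeT.
have /connectP[p0 pp0 ->] := con s x.
case/shortenP: pp0 => -[|u p] /=; first by rewrite eqxx.
case/andP=> su pp /andP[sp _] _ _; exists u => //; rewrite inE.
apply/connectP; exists p => //.
by rewrite (eq_path (del_edgeC u s)) path_del_edge.
Qed.

(** An edge other than [u -- s] that leaves the intersection of the two sides stays in [side u s],
    so it must be [s -- t]; then [s] would lie in [side u s], against [bridge]. *)
Lemma side_nest s t u : s -- t -> s -- u -> u != t -> side u s \subset side s t.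
Proof.
move=> st su ut; have us : u -- s by rewrite sedge_sym.
have uS : u \in side s t.
  rewrite inE connect1 // /del_edge su; apply/eqP => /setP/(_ u).
  rewrite !inE eqxx orbT (negPf ut) orbF => /esym/eqP e.
  by rewrite e sedge_irr in su.
suff h : side u s \subset side s t :&: side u s.
  by apply: subset_trans h (subsetIl _ _).
apply: side_sub => [|x y]; first by rewrite inE uS mem_side.
rewrite !in_setI => /andP[xst xus]; rewrite negb_and => ny xy.
apply/eqP/negPn/negP => ne.
have yus : y \in side u s.
  move: xus; rewrite !inE => xus; apply: connect_trans xus (connect1 _).
  by rewrite /del_edge xy.
have e : [set x; y] = [set s; t].
  apply/eqP/negPn/negP => ne'; move: ny; rewrite yus orbF => /negP[].
  move: xst; rewrite !inE => xst; apply: connect_trans xst (connect1 _).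
  by rewrite /del_edge xy.
have : s \in [set x; y] by rewrite e !inE eqxx.
by rewrite !inE => /orP[]/eqP sE; case/negP: (bridge us); rewrite {1}sE.
Qed.

Lemma side_cover s t : s -- t -> side s t :|: side t s = setT.
Proof.
move=> st; apply/setP => x; rewrite in_setU in_setT.
have [->|xs] := eqVneq x s; first by rewrite mem_side.
have [u su xu] := side_step xs.
have [<-|ut] := eqVneq u t; first by rewrite xu orbT.
by rewrite (subsetP (side_nest st su ut)).
Qed.

Lemma side_setC s t : s -- t -> side t s = ~: side s t.
Proof.
move=> st; apply/setP => x; rewrite in_setC.
have /setP/(_ x) := side_cover st; rewrite in_setU in_setT.
have [xs _|xs /= ->//] := boolP (x \in side s t).
by rewrite (disjointFr (side_disj st) xs).
Qed.

(** The recursion that reads a cubic tree as a binary one: seen from [t], the subtrees below [s]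
    hang at its other neighbours. *)
Lemma side_children s t : s -- t ->
  side s t = s |: \bigcup_(u in [set u | s -- u & u != t]) side u s.
Proof.
move=> st; apply/setP => x; rewrite in_setU1.
have [->|xs] /= := eqVneq x s; first exact: mem_side.
apply/idP/bigcupP => [xst|[u]]; last first.
  by rewrite inE => /andP[su ut]; apply/subsetP/side_nest.
have [u su xu] := side_step xs; exists u => //; rewrite inE su /=.
apply/eqP => ut; subst u.
by rewrite (disjointFr (side_disj st) xst) in xu.
Qed.

End TreeSides.

(* [tree_split P X] is a binary tree with leaf set X, all of whose subtrees
   have a leaf set satisfying P. *)
Inductive tree_split (V : finType) (P : {set V} -> Prop) : {set V} -> Prop :=
| TreeLeaf x : P [set x] -> tree_split P [set x]
| TreeNode X Y : tree_split P X -> tree_split P Y -> [disjoint X & Y] ->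
    P (X :|: Y) -> tree_split P (X :|: Y).

(** * From labelled cubic trees to binary trees *)

Section TreeSplit.
Variables (V : finType) (P : {set V} -> Prop).

Lemma tree_splitP X : tree_split P X -> P X.
Proof. by case. Qed.

Lemma tree_split_neq0 X : tree_split P X -> X != set0.
Proof.
elim=> [x _|{}X Y _ /set0Pn[x xX] _ _ _ _]; apply/set0Pn; exists x.
  by rewrite set11.
by rewrite inE xX.
Qed.

Lemma tree_split_leaf X x : tree_split P X -> x \in X -> P [set x].
Proof.
elim=> [y Py /set1P->//|{}X Y _ IX _ IY _ _].
by rewrite inE => /orP[].
Qed.

Lemma tree_split_root : tree_split P setT -> 1 < #|V| ->
  exists2 X, tree_split P X & tree_split P (~: X).
Proof.
move=> h V1; have [X eX] : exists X : {set V}, X = setT by exists setT.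
rewrite -eX in h; case: h eX => [x _ e|{}X Y bX bY dXY _ e].
  by rewrite -cardsT -e cards1 in V1.
exists X => //; suff -> : ~: X = Y by [].
apply/setP => x; rewrite inE; have /setP/(_ x) := e; rewrite !inE.
by have [/(disjointFr dXY)->|_ /= ->] := boolP (x \in X).
Qed.

(** Pruning: leaves outside the image of [f] vanish, and a node left with one nonempty child is
    replaced by that child. The first alternative is a subtree that vanishes altogether. *)
Lemma tree_split_preimset (W : finType) (Q : {set W} -> Prop) (f : W -> V) X :
  injective f -> (forall X, P X -> Q (f @^-1: X)) -> tree_split P X ->
  f @^-1: X = set0 \/ tree_split Q (f @^-1: X).
Proof.
move=> inj PQ; elim=> [x /PQ Qx|{}X Y _ IX _ IY dXY /PQ].
  have [/set0Pn[w]|/negbNE/eqP->] := boolP (f @^-1: [set x] != set0); last by left.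
  rewrite !inE => /eqP fw; right; rewrite -fw in Qx *.
  have wE : f @^-1: [set f w] = [set w].
    by apply/setP => u; rewrite !inE (inj_eq inj).
  by rewrite wE in Qx *; apply: TreeLeaf.
rewrite preimsetU; case: IX => [->|bX]; first by rewrite set0U; case: IY; auto.
case: IY => [->|bY]; first by rewrite setU0; auto.
move=> QXY; right; apply: TreeNode => //.
rewrite -setI_eq0 -preimsetI; apply/eqP/setP => w.
by rewrite (eqP (_ : X :&: Y == set0)) ?setI_eq0 // !inE.
Qed.

(** Root the tree at one of its edges. Seen from its neighbour [t], a non-leaf [s] has exactly two
    further neighbours, whose sides are the two children. *)
Lemma decomposition_tree_split (T : sgraph) (d : leaf_of T -> V) :
  decomposition d -> (forall s t, s -- t -> P (shore d s t)) ->
  exists2 X, tree_split P X & tree_split P (~: X).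
Proof.
move=> [[treeT T3] [d' dK d'K]] shoreP.
have shoreE s t v : (v \in shore d s t) = (val (d' v) \in side s t).
  apply/imsetP/idP => [[l]|vs]; first by rewrite !inE => ls ->; rewrite dK.
  by exists (d' v); [move: vs; rewrite !inE | rewrite d'K].
have branch s t : s -- t -> tree_split P (shore d s t).
  (* The side of a child is strictly smaller, since it lacks [s]. *)
  have [m] := ubnP #|side s t|; elim: m s t => // m IH s t lem st.
  have [ls|nl] := boolP (leaf s).
    have sE : side s t = [set s].
      rewrite side_children // (_ : [set u | _] = set0) ?big_set0 ?setU0 //.
      apply/setP => u; rewrite !inE; apply/andP => -[su /eqP[]].
      have /cards1P[w wE] := ls.
      have /set1P-> : u \in [set w] by rewrite -wE inE.
      by apply/esym/set1P; rewrite -wE inE.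
    have shE : shore d s t = [set d (Sub s ls)].
      apply/setP => v; rewrite shoreE sE !inE.
      by rewrite -(can_eq d'K) dK -val_eqE.
    by have := shoreP _ _ st; rewrite shE; apply: TreeLeaf.
  have [u [w [uw nsE]]] : exists u w, u != w /\ [set u | s -- u & u != t] = [set u; w].
    have /eqP/cards2P[u [w [uw e]]] : #|[set u | s -- u & u != t]| = 2.
      have := T3 _ nl; rewrite /degree (cardsD1 t) inE st add1n => -[<-].
      by apply: eq_card => x; rewrite !inE andbC.
    by exists u, w.
  have nbr x : x \in [set u; w] -> s -- x /\ x != t.
    by rewrite -nsE inE => /andP.
  have [su ut] : s -- u /\ u != t by apply: nbr; rewrite !inE eqxx.
  have [sw wt] : s -- w /\ w != t by apply: nbr; rewrite !inE eqxx orbT.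
  have step x : s -- x -> x != t -> tree_split P (shore d x s).
    move=> sx xt; apply: IH; last by rewrite sedge_sym.
    rewrite -ltnS; apply: leq_trans lem; rewrite ltnS; apply: proper_card.
    rewrite properE side_nest //; apply/subsetPn; exists s; first exact: mem_side.
    by have := mem_side s x; rewrite side_setC ?in_setC // sedge_sym.
  have shE : shore d s t = shore d u s :|: shore d w s.
    apply/setP => v; rewrite in_setU !shoreE side_children // nsE.
    rewrite bigcup_setU !big_set1 !in_setU in_set1.
    by have [e|//] := eqVneq; move: (valP (d' v)); rewrite e (negPf nl).
  have := shoreP _ _ st; rewrite shE; apply: TreeNode; try exact: step.
  apply/pred0P => v /=; rewrite !shoreE; apply/andP => -[vu].
  have wu : w != u by rewrite eq_sym.
  move/(subsetP (side_nest treeT su sw wu)).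
  by rewrite (side_setC treeT _) ?in_setC ?vu // sedge_sym.
have [[T0 con] _] := treeT.
have /card_gt0P[s _] := T0.
have [t st] : exists t, s -- t.
  have : 0 < degree s by have [/eqP->|/T3->] := boolP (leaf s).
  by case/card_gt0P => t; rewrite inE; exists t.
exists (shore d s t); first exact: branch.
suff -> : ~: shore d s t = shore d t s by apply: branch; rewrite sedge_sym.
by apply/setP => v; rewrite in_setC !shoreE (side_setC treeT st) in_setC.
Qed.
End TreeSplit.

(** * Joining two trees by an edge *)

Section Join.
Variables (T1 T2 : sgraph) (r1 : T1) (r2 : T2).

Definition join_edge (u v : T1 + T2) : bool :=
  match u, v with
  | inl x, inl y => x -- y
  | inr x, inr y => x -- y
  | inl x, inr y | inr y, inl x => (x == r1) && (y == r2)
  end.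

Lemma join_edge_sym : symmetric join_edge.
Proof. by case=> x; case=> y //=; rewrite sedge_sym. Qed.

Lemma join_edge_irr : irreflexive join_edge.
Proof. by case=> x /=; rewrite sedge_irr. Qed.

Definition join : sgraph := SGraph join_edge_sym join_edge_irr.

Lemma join_degree_inl (x : T1) :
  degree (inl x : join) = degree x + (x == r1).
Proof.
rewrite {1}/degree -sum1dep_card big_sumType /= sum1dep_card; congr (_ + _).
by case: (x == r1); rewrite /= ?big_pred1_eq ?big_pred0_eq.
Qed.

Lemma join_degree_inr (x : T2) :
  degree (inr x : join) = degree x + (x == r2).
Proof.
rewrite {1}/degree -sum1dep_card big_sumType /= addnC sum1dep_card.
congr (_ + _); case: (x == r2).
  by rewrite (eq_bigl (pred1 r1)) ?big_pred1_eq // => y; rewrite andbT.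
by rewrite big_pred0 // => y; rewrite andbF.
Qed.

(** All of [T2] hangs at [r1], so it can only be reached on the side that contains [r1]. *)
Lemma join_side_inl (s t : T1) :
  side (inl s : join) (inl t) \subset
  [set u | match u with inl x => x \in side s t | inr _ => r1 \in side s t end].
Proof.
apply: side_sub => [|[x|x] [y|y]]; rewrite ?inE //.
- move=> sx sy /= xy.
  have /eqP e : [set x; y] == [set s; t].
    apply: contraNT sy => ne; apply: connect_trans sx (connect1 _).
    by rewrite /del_edge xy.
  apply/setP => -[w|w]; rewrite !inE //.
  by have /setP/(_ w) := e; rewrite !inE.
- by move=> sx nr /= /andP[/eqP e]; rewrite e (negPf nr) in sx.
- by move=> r ns /= /andP[/eqP e]; rewrite e r in ns.
- by move=> ->.
Qed.

Lemma join_side_inr (s t : T2) :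
  side (inr s : join) (inr t) \subset
  [set u | match u with inr x => x \in side s t | inl _ => r2 \in side s t end].
Proof.
apply: side_sub => [|[x|x] [y|y]]; rewrite ?inE //.
- by move=> ->.
- by move=> r ns /= /andP[_ /eqP e]; rewrite e r in ns.
- by move=> sx nr /= /andP[_ /eqP e]; rewrite e (negPf nr) in sx.
- move=> sx sy /= xy.
  have /eqP e : [set x; y] == [set s; t].
    apply: contraNT sy => ne; apply: connect_trans sx (connect1 _).
    by rewrite /del_edge xy.
  apply/setP => -[w|w]; rewrite !inE //.
  by have /setP/(_ w) := e; rewrite !inE.
Qed.

Lemma join_side_root :
  side (inr r2 : join) (inl r1) \subset
  [set u | match u with inr x => true | inl _ => false end].
Proof.
apply: side_sub => [|[x|x] [y|y]]; rewrite !in_set //.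
by move=> _ _ /= /andP[/eqP-> /eqP->].
Qed.

Lemma join_connect_inl (s t x y : T1) :
  connect (del_edge s t) x y ->
  connect (@del_edge join (inl s) (inl t)) (inl x) (inl y).
Proof.
move=> /connectP[p pp ->]; apply/connectP; exists (map inl p).
  rewrite path_map; apply: sub_path pp => u v /andP[uv ne] /=.
  rewrite /del_edge /= uv; apply: contra ne => /eqP/setP e.
  by apply/eqP/setP => w; have := e (inl w); rewrite !inE.
by rewrite last_map.
Qed.

Lemma join_connect_inr (s t x y : T2) :
  connect (del_edge s t) x y ->
  connect (@del_edge join (inr s) (inr t)) (inr x) (inr y).
Proof.
move=> /connectP[p pp ->]; apply/connectP; exists (map inr p).
  rewrite path_map; apply: sub_path pp => u v /andP[uv ne] /=.
  rewrite /del_edge /= uv; apply: contra ne => /eqP/setP e.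
  by apply/eqP/setP => w; have := e (inr w); rewrite !inE.
by rewrite last_map.
Qed.

(** By [acyclicP] each edge has to be a bridge: an old edge is one because the sides in the join
    restrict to old sides, the new edge because it is the only link between the halves. *)
Lemma join_tree : tree T1 -> tree T2 -> tree join.
Proof.
move=> tree1 tree2; have [[_ con1] ac1] := tree1; have [[_ con2] ac2] := tree2.
have to_r u : connect (@sedge join) (inl r1) u.
  case: u => [x|x].
    have /connectP[p pp ->] := con1 r1 x; apply/connectP.
    by exists (map inl p); rewrite ?path_map ?last_map.
  apply: (@connect_trans _ _ (inr r2)); first by apply: connect1; rewrite /= !eqxx.
  have /connectP[p pp ->] := con2 r2 x; apply/connectP.
  by exists (map inr p); rewrite ?path_map ?last_map.
have symc := sym_connect_sym (@sedge_sym join).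
have sideC (s t : join) : t \notin side s t -> s \notin side t s.
  rewrite !inE (eq_connect (del_edgeC t s)).
  by rewrite (sym_connect_sym (@del_edge_sym _ s t)).
split; first split=> [|u v].
- by apply/card_gt0P; exists (inl r1).
- by apply: connect_trans (to_r v); rewrite symc.
apply/acyclicP => -[s|s] [t|t] st.
- have := @bridge _ tree1 s t st.
  by apply: contra => /(subsetP (join_side_inl s t)); rewrite in_set.
- case/andP: st => /eqP-> /eqP->; apply: sideC.
  by apply/negP => /(subsetP join_side_root); rewrite in_set.
- case/andP: st => /eqP-> /eqP->.
  by apply/negP => /(subsetP join_side_root); rewrite in_set.
- have := @bridge _ tree2 s t st.
  by apply: contra => /(subsetP (join_side_inr s t)); rewrite in_set.
Qed.
End Join.

(** * From binary trees back to labelled cubic trees *)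

Section Planted.
Variables (V : finType) (P : {set V} -> Prop).

(* A cubic tree with leaf set L labelled by X, in which the root r still lacks
   k edges; the sides of tree edges away from r have their label set in P. *)
Definition planted (k : nat) (X : {set V}) : Prop :=
  exists (T : sgraph) (r : T) (L : {set T}) (d : T -> V),
  [/\ tree T, forall x, degree x + (x == r) * k = if x \in L then 1 else 3,
      {in L &, injective d}, d @: L = X
    & forall s t, s -- t -> r \notin side s t -> P (d @: (L :&: side s t))].

Definition point : sgraph :=
  @SGraph unit (fun _ _ => false) (fun _ _ => erefl) (fun _ => erefl).

Lemma point_tree : tree point.
Proof.
split; first by split=> [|[] []]; [rewrite card_unit | exact: connect0].
by case=> [|[] [|[] c]].
Qed.

Lemma point_degree (x : point) : degree x = 0.
Proof. by apply/eqP; rewrite cards_eq0; apply/eqP/setP => y; rewrite !inE. Qed.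

Lemma planted_leaf x : planted 1 [set x].
Proof.
exists point, tt, setT, (fun _ => x); split=> //.
- exact: point_tree.
- by case; rewrite point_degree in_setT.
- by case=> -[].
- by apply/setP => y; apply/imsetP/set1P => [[]//|->]; exists tt.
Qed.

(** The seed of an inner node: one vertex outside [L] that lacks all three edges. Since [L] is
    empty, [x0] is only a default value for the labelling. *)
Lemma planted_fork (x0 : V) : planted 3 set0.
Proof.
exists point, tt, set0, (fun _ => x0); split=> //.
- exact: point_tree.
- by case; rewrite point_degree in_set0.
- by move=> x y; rewrite in_set0.
- exact: imset0.
Qed.

(** The new edge supplies one missing edge at [r1] and the only one at [r2]. A side away from [r1]
    either comes from an old side away from its root, or is all of [T2], whose label set is [X2]. *)
Lemma planted_join k X1 X2 :
  planted k.+1 X1 -> planted 1 X2 -> P X2 -> [disjoint X1 & X2] ->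
  planted k (X1 :|: X2).
Proof.
move=> [T1 [r1 [L1 [d1 [tree1 deg1 inj1 X1E P1]]]]].
move=> [T2 [r2 [L2 [d2 [tree2 deg2 inj2 X2E P2]]]]] PX2 dX.
pose L : {set join r1 r2} :=
  [set u | match u with inl x => x \in L1 | inr x => x \in L2 end].
pose d (u : join r1 r2) := match u with inl x => d1 x | inr x => d2 x end.
have neq x y : x \in L1 -> y \in L2 -> d1 x <> d2 y.
  move=> xL yL e; have := disjointFr dX; rewrite -X1E -X2E.
  by move/(_ (d1 x) (imset_f _ xL)); rewrite e imset_f.
exists (join r1 r2), (inl r1), L, d; split.
- exact: join_tree.
- case=> x; rewrite in_set.
    by rewrite join_degree_inl -deg1 -addnA mulnS.
  by rewrite join_degree_inr -deg2 muln1 mul0n addn0.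
- case=> x [y|y]; rewrite !in_set /= => xL yL e.
  + by congr inl; apply: inj1.
  + by case: (neq x y).
  + by case: (neq y x).
  + by congr inr; apply: inj2.
- apply/setP => v; rewrite in_setU -X1E -X2E; apply/imsetP/orP.
    by case=> -[x|x]; rewrite in_set => xL ->; [left|right]; apply: imset_f.
  by case=> /imsetP[x xL ->]; [exists (inl x) | exists (inr x)]; rewrite ?in_set.
case=> s [t|t] st nr.
- have nr1 : r1 \notin side s t.
    by apply: contra nr; rewrite !inE; apply: join_connect_inl.
  have := P1 _ _ st nr1; congr P; apply/setP => v; apply/imsetP/imsetP.
    case=> x; rewrite !inE => /andP[xL xs] ->.
    by exists (inl x); rewrite // !inE xL; apply: join_connect_inl.
  case=> -[x|x]; rewrite in_setI => /andP[]; rewrite in_set => xL.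
    move/(subsetP (join_side_inl _ _ _ _)); rewrite in_set => xs ->.
    by exists x; rewrite // in_setI xL.
  by move/(subsetP (join_side_inl _ _ _ _)); rewrite in_set (negPf nr1).
- by case/andP: st nr => /eqP-> _; rewrite mem_side.
- case/andP: st => /eqP et /eqP es; subst t s.
  have := PX2; congr P; rewrite -X2E; apply/setP => v; apply/imsetP/imsetP.
    case=> x xL ->; exists (inr x); rewrite // !inE xL /=.
    have [[_ con2] _] := tree2; have /connectP[p pp ->] := con2 r2 x.
    apply/connectP; exists (map inr p); last by rewrite last_map.
    rewrite path_map; apply: sub_path pp => u w uw; rewrite /= /del_edge /= uw.
    by apply/eqP => /setP/(_ (inl r1)); rewrite !inE eqxx.
  case=> -[x|x]; rewrite in_setI => /andP[]; rewrite in_set => xL.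
    by move/(subsetP (join_side_root _ _)); rewrite in_set.
  by exists x.
(* The new edge survives this deletion, so a side that misses the root [inl r1] misses [r2] as
   well. *)
- have rr : connect (@del_edge (join r1 r2) (inr s) (inr t)) (inr r2) (inl r1).
    apply: connect1; rewrite /del_edge /= !eqxx /=.
    by apply/eqP => /setP/(_ (inl r1)); rewrite !inE eqxx.
  have nr2 : r2 \notin side s t.
    apply: contra nr; rewrite !inE => h; apply: connect_trans rr.
    exact: join_connect_inr.
  have := P2 _ _ st nr2; congr P; apply/setP => v; apply/imsetP/imsetP.
    case=> x; rewrite !inE => /andP[xL xs] ->.
    by exists (inr x); rewrite // !inE xL; apply: join_connect_inr.
  case=> -[x|x]; rewrite in_setI => /andP[]; rewrite in_set => xL.
    by move/(subsetP (join_side_inr _ _ _ _)); rewrite in_set (negPf nr2).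
  move/(subsetP (join_side_inr _ _ _ _)); rewrite in_set => xs ->.
  by exists x; rewrite // in_setI xL.
Qed.

(** At a node the two planted subtrees are attached to a fork one after the other, so the missing
    edges drop from three to one. *)
Lemma tree_split_planted X : tree_split P X -> planted 1 X.
Proof.
elim=> [x _|{}X Y bX pX bY pY dXY _]; first exact: planted_leaf.
have /set0Pn[x _] := tree_split_neq0 bX.
have d0 : [disjoint set0 & X] by rewrite -setI_eq0 set0I.
have := planted_join (planted_fork x) pX (tree_splitP bX) d0.
by rewrite set0U => /planted_join; apply=> //; apply: tree_splitP.
Qed.

(** Joining the two planted halves leaves no edge missing, so all degrees are 1 or 3. Closure of [P]
    under complements handles the sides that contain the root [r]. *)
Lemma tree_split_decomposition X : (forall Y, P Y -> P (~: Y)) ->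
  tree_split P X -> tree_split P (~: X) ->
  exists (T : sgraph) (d : leaf_of T -> V),
    decomposition d /\ forall s t, s -- t -> P (shore d s t).
Proof.
move=> PC bX bX'; have dX : [disjoint X & ~: X] by rewrite -setI_eq0 setICr.
have := planted_join (tree_split_planted bX) (tree_split_planted bX')
  (tree_splitP bX') dX.
rewrite setUCr => -[T [r [L [d [treeT deg inj dL PT]]]]].
have lE (x : T) : leaf x = (x \in L).
  by have := deg x; rewrite /leaf muln0 addn0 => ->; case: (x \in L).
have LP (l : leaf_of T) : val l \in L by rewrite -lE (valP l).
have shE s t : shore (fun l : leaf_of T => d (val l)) s t = d @: (L :&: side s t).
  apply/setP => v; apply/imsetP/imsetP.
    by case=> l; rewrite in_set => ls ->; exists (val l); rewrite // !inE LP.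
  case=> x; rewrite in_setI -lE => /andP[lx xs] ->.
  by exists (Sub x lx); rewrite ?SubK //; move: xs; rewrite !inE SubK.
exists T, (fun l => d (val l)); split=> [|s t st]; last first.
  rewrite shE; have [rs|] := boolP (r \in side s t); last exact: PT.
  have ts : t -- s by rewrite sedge_sym.
  have nr : r \notin side t s by rewrite side_setC // in_setC rs.
  have := PC _ (PT _ _ ts nr); congr P; apply/setP => v.
  have /imsetP[x xL ->] : v \in d @: L by rewrite dL in_setT.
  have dm (S : {set T}) : (d x \in d @: (L :&: S)) = (x \in S).
    apply/imsetP/idP => [[y /setIP[yL yS] /inj->//]|xS].
    by exists x; rewrite // in_setI xL.
  by rewrite in_setC !dm side_setC // in_setC negbK.
split.
  by split=> // x; rewrite lE => /negPf xL; have := deg x; rewrite xL muln0 addn0.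
have dsur v : exists l : leaf_of T, d (val l) == v.
  have /imsetP[x xL ->] : v \in d @: L by rewrite dL in_setT.
  by rewrite -lE in xL; exists (Sub x xL); rewrite SubK.
exists (fun v => xchoose (dsur v)).
  by move=> l; apply/val_inj/inj; rewrite ?LP //; apply/eqP/(xchooseP (dsur _)).
by move=> v; apply/eqP/(xchooseP (dsur _)).
Qed.
End Planted.

(** * Families of disjoint dicycles as permutations *)

Section ArcPerm.
Variable D : digraph.
Implicit Types (sigma : D -> D) (Y : {set D}).

(** As [D] is finite, such a [sigma] is a permutation; its fixed points stand for the vertices on no
    cycle. *)
Definition arc_perm sigma : Prop :=
  injective sigma /\ forall e, sigma e != e -> Defs.arc e (sigma e).

Definition crossing sigma Y : {set D} :=
  [set e | (e \in Y) != (sigma e \in Y)].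

(** The cycles are the orbits of the moved vertices. Each is listed from its [froot], so that one
    orbit yields one sequence; two rotations of it would count as distinct members that are not
    disjoint. *)
Lemma arc_perm_dicycles sigma : arc_perm sigma ->
  exists2 C : {set #|D|.-bseq D}, disjoint_dicycles C &
    forall e, sigma e != e -> (e, sigma e) \in \bigcup_(c in C) cycle_arcs c.
Proof.
move=> [inj arcs].
have bound x : size (orbit sigma x) <= #|D| by rewrite size_orbit max_card.
pose orb x : #|D|.-bseq D := Bseq (bound x).
have symc := fconnect_sym inj.
have mem_orb x y :
    (y \in (orb (froot sigma x) : seq D)) = (froot sigma x == froot sigma y).
  by rewrite /= -fconnect_orbit -(root_connect symc) root_root.
(* A fixed point is alone in its orbit, so the orbit of a moved vertex follows arcs throughout. *)
have fix_root x y : sigma y = y -> froot sigma x = froot sigma y -> x = y.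
  move=> fy /esym/(rootP symc); rewrite fconnect_orbit.
  rewrite /orbit => /trajectP[n _ ->]; by elim: n => //= n ->.
exists [set orb (froot sigma x) | x in [set x | sigma x != x]]; last first.
  move=> e ne; apply/bigcupP; exists (orb (froot sigma e)).
    by apply: imset_f; rewrite inE.
  apply/imsetP; exists e; first by rewrite mem_orb.
  by rewrite (nextE (cycle_orbit inj _)) // mem_orb.
apply/andP; split; apply/forall_inP => c /imsetP[x]; rewrite inE => nx ->.
  apply/andP; split.
    apply/eqP => e; have := mem_orb x x.
    by rewrite eqxx [LHS](_ : _ = (x \in [::])) // -e.
  apply/andP; split; last exact: orbit_uniq.
  pose o := orbit sigma (froot sigma x).
  apply: (@sub_in_cycle _ (mem o) _ _ _ o _ (cycle_orbit inj _)); last exact/allP.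
  move=> y z yx _ /eqP <-; apply: arcs; apply/eqP => fy.
  have := mem_orb x y; rewrite [LHS]yx => /esym/eqP /(fix_root _ _ fy) e.
  by rewrite e fy eqxx in nx.
apply/forall_inP => c' /imsetP[y _ ->]; apply/implyP; apply: contraNT.
case/pred0Pn => z /andP[zx zy].
have /eqP ex := etrans (esym (mem_orb x z)) zx.
have /eqP ey := etrans (esym (mem_orb y z)) zy.
by rewrite ex -ey.
Qed.

Lemma crossing_le_porosity sigma Y :
  arc_perm sigma -> #|crossing sigma Y| <= cycle_porosity Y.
Proof.
move=> ap; have [C disjC covC] := arc_perm_dicycles ap.
have := @leq_bigmax_cond _ (@disjoint_dicycles D)
  (fun C => #|dcut Y :&: \bigcup_(c in C) cycle_arcs c|) C disjC.
apply: leq_trans; rewrite -(@card_imset _ _ (fun e => (e, sigma e))); last first.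
  by move=> e f [].
apply/subset_leq_card/subsetP => _ /imsetP[e eY ->]; rewrite inE in eY.
have ne : sigma e != e by apply: contraNneq eY => ->.
by rewrite !inE /= covC // eY ap.2.
Qed.

(** Take the successor on the cycle through a vertex, unique by disjointness, and the identity off
    the cycles. *)
Lemma dicycles_arc_perm (C : {set #|D|.-bseq D}) : disjoint_dicycles C ->
  exists2 sigma, arc_perm sigma &
    forall a, a \in \bigcup_(c in C) cycle_arcs c -> sigma a.1 = a.2.
Proof.
case/andP=> /forall_inP cyc /forall_inP disjC.
have same c c' e : c \in C -> c' \in C -> e \in c -> e \in c' -> c = c'.
  move=> cC c'C ec ec'; apply/eqP; have /forall_inP/(_ _ c'C) := disjC _ cC.
  by apply: contraTT => ne /=; rewrite ne /= disjoint_has negbK; apply/hasP; exists e.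
pose sigma e := if [pick c in C | e \in c] is Some c then next c e else e.
have sigmaE c e : c \in C -> e \in c -> sigma e = next c e.
  move=> cC ec; rewrite /sigma; case: pickP => [c' /andP[c'C ec']|/(_ c)].
    by rewrite (same _ _ _ cC c'C ec ec').
  by rewrite cC ec.
have sigma_cases e : sigma e = e \/ exists2 c, c \in C & e \in c.
  rewrite /sigma; case: pickP => [c /andP[cC ec]|_]; last by left.
  by right; exists c.
exists sigma; last first.
  by move=> a /bigcupP[c cC /imsetP[e ec ->]]; apply: sigmaE.
split=> [e f|e]; last first.
  have [->|[c cC ec]] := sigma_cases e; first by rewrite eqxx.
  move=> _; rewrite (sigmaE c) //; have /andP[_ /andP[cc _]] := cyc _ cC.
  exact: next_cycle cc ec.
(* If neither vertex is on a cycle both are fixed; otherwise they may be swapped. *)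
wlog [c cC ec] : e f / exists2 c, c \in C & e \in c => [hw|] efE.
  have [eE|he] := sigma_cases e; last exact: hw efE.
  have [fE|hf] := sigma_cases f; first by rewrite -eE -fE.
  by apply/esym/hw.
have nec : next c e \in c by rewrite mem_next.
have fc : f \in c.
  have [fE|[c' c'C fc']] := sigma_cases f; first by rewrite -fE -efE (sigmaE c).
  rewrite (same c c' (next c e)) //.
  by rewrite -(sigmaE c) // efE (sigmaE c') // mem_next.
have /andP[_ /andP[_ un]] := cyc _ cC.
by apply: (can_inj (prev_next un)); rewrite -!(sigmaE c).
Qed.

Lemma cycle_porosity_leq Y k :
  (forall sigma, arc_perm sigma -> #|crossing sigma Y| <= k) ->
  cycle_porosity Y <= k.
Proof.
move=> h; apply/bigmax_leqP => C /dicycles_arc_perm[sigma ap sigmaE].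
apply: leq_trans (h _ ap); apply: leq_trans (leq_imset_card (fun e => (e, sigma e)) _).
apply/subset_leq_card/subsetP => -[e f] /setIP[]; rewrite inE /=.
case/andP=> _ ef /sigmaE /= eE; apply/imsetP; exists e; last by rewrite eE.
by rewrite inE eE.
Qed.
End ArcPerm.

(** * Perfect matchings of a bipartite graph as permutations *)

Lemma mem_edge_set (G : sgraph) (x y : G) : x -- y -> [set x; y] \in edge_set G.
Proof. by move=> xy; apply/imsetP; exists (x, y); rewrite ?inE. Qed.

Lemma mem_cut (G : sgraph) (X : {set G}) x y : x -- y ->
  ([set x; y] \in cut X) = ((x \in X) != (y \in X)).
Proof.
move=> xy; have ne : y != x.
  by apply/eqP => e; rewrite e sedge_irr in xy.
rewrite inE mem_edge_set //= (cardsD1 x) (cardsD1 y) (_ : _ :\ y = set0).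
  by rewrite cards0 !inE !eqxx ne orbT; case: (x \in X); case: (y \in X).
by apply/setP => z; rewrite !inE; do 2!case: eqP.
Qed.

(** Turns a perfect matching, given as a set of edges, into functions between its edges and their
    ends in [A] and [B]. It serves both the fixed [M] and a second matching [M']. *)
Record coords (G : sgraph) (A B : {set G}) (M : {set {set G}}) := Coords {
  fst_end : mdir_vertex M -> G;
  snd_end : mdir_vertex M -> G;
  medge : G -> mdir_vertex M;
  coords_val e : val e = [set fst_end e; snd_end e];
  fst_endA e : fst_end e \in A;
  snd_endB e : snd_end e \in B;
  coords_edge e : fst_end e -- snd_end e;
  medge_fst e : medge (fst_end e) = e;
  medge_snd e : medge (snd_end e) = e;
  fst_medge x : x \in A -> fst_end (medge x) = x;
  snd_medge x : x \in B -> snd_end (medge x) = x }.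

Section Bipartite.
Variables (G : sgraph) (A B : {set G}).
Hypothesis hAB : bipartition A B.
Implicit Types (M : {set {set G}}) (X : {set G}).

Lemma coords_ex M : perfect_matching M -> inhabited (coords A B M).
Proof.
have [covAB dAB bip] := hAB; case/andP=> /subsetP Me /forallP Mx.
have ends (e : mdir_vertex M) : exists p : G * G,
    [/\ val e = [set p.1; p.2], p.1 \in A, p.2 \in B & p.1 -- p.2].
  have /imsetP[[x y]] := Me _ (valP e); rewrite inE /= => xy ->.
  have /orP[/andP[xA yB]|/andP[xB yA]] := bip _ _ xy; first by exists (x, y).
  by exists (y, x); rewrite /= setUC sedge_sym.
have [p pE] := fin_all_exists ends.
have edge_at x : exists e : mdir_vertex M, x \in val e.
  have /cards1P[e eE] := Mx x; have : e \in [set e] by rewrite inE.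
  by rewrite -eE inE => /andP[eM xe]; exists (Sub e eM).
have [m mE] := fin_all_exists edge_at.
have m_uniq x (e : mdir_vertex M) : x \in val e -> m x = e.
  move=> xe; have /cards1P[e0 e0E] := Mx x; apply: val_inj.
  have eq0 (f : mdir_vertex M) : x \in val f -> val f = e0.
    by move=> xf; apply/set1P; rewrite -e0E inE xf (valP f).
  exact: etrans (eq0 _ (mE x)) (esym (eq0 _ xe)).
constructor; apply: (@Coords _ A B M (fun e => (p e).1) (fun e => (p e).2) m).
- by move=> e; case: (pE e).
- by move=> e; case: (pE e).
- by move=> e; case: (pE e).
- by move=> e; case: (pE e).
- by move=> e; apply: m_uniq; have [-> _ _ _] := pE e; rewrite !inE eqxx.
- by move=> e; apply: m_uniq; have [-> _ _ _] := pE e; rewrite !inE eqxx orbT.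
- move=> x xA; have [e _ yB _] := pE (m x); have := mE x; rewrite e.
  by rewrite !inE => /orP[/eqP//|/eqP xE]; rewrite -xE (disjointFr dAB xA) in yB.
- move=> x xB; have [e yA _ _] := pE (m x); have := mE x; rewrite e.
  by rewrite !inE => /orP[/eqP xE|/eqP//]; rewrite -xE (disjointFl dAB xB) in yA.
Qed.

Section Matching.
Variables (M : {set {set G}}) (K : coords A B M).
Let D := mdirection A B M.
Implicit Types (Y : {set D}) (e f : D).

Lemma fst_inj : injective (fst_end K).
Proof. exact: can_inj (medge_fst K). Qed.

Lemma mdir_arcE e f : Defs.arc e f = (e != f) && (fst_end K e -- snd_end K f).
Proof.
have [_ dAB _] := hAB; rewrite /= /mdir_arc; congr (_ && _).
apply/exists_inP/idP => [[x]|ef].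
  rewrite inE (coords_val K) !inE => /andP[/orP[]/eqP-> xA]; last first.
    by have := snd_endB K e; rewrite (disjointFr dAB xA).
  case/exists_inP=> y; rewrite inE (coords_val K) !inE.
  case/andP=> /orP[]/eqP-> // yB.
  by have := fst_endA K f; rewrite (disjointFl dAB yB).
exists (fst_end K e); first by rewrite inE (coords_val K) !inE eqxx fst_endA.
apply/exists_inP; exists (snd_end K f) => //.
by rewrite inE (coords_val K) !inE eqxx orbT snd_endB.
Qed.

Lemma arc_perm_edge (sigma : D -> D) e :
  arc_perm sigma -> fst_end K e -- snd_end K (sigma e).
Proof.
move=> [_ arcs]; have [->|ne] := eqVneq (sigma e) e; first exact: coords_edge.
by have := arcs e ne; rewrite mdir_arcE => /andP[].
Qed.

Definition matching_of (sigma : D -> D) : {set {set G}} :=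
  [set [set fst_end K e; snd_end K (sigma e)] | e : D].

Lemma perfect_matching_of sigma : arc_perm sigma -> perfect_matching (matching_of sigma).
Proof.
move=> ap; have [covAB dAB _] := hAB.
apply/andP; split.
  apply/subsetP => _ /imsetP[e _ ->]; apply: mem_edge_set; exact: arc_perm_edge.
have fst_ne x e : x \in B -> (x == fst_end K e) = false.
  move=> xB; apply/eqP => xE; have := fst_endA K e.
  by rewrite -xE (disjointFl dAB xB).
have snd_ne x e : x \in A -> (x == snd_end K e) = false.
  move=> xA; apply/eqP => xE; have := snd_endB K e.
  by rewrite -xE (disjointFr dAB xA).
apply/forallP => x; apply/cards1P.
have /setP/(_ x) := covAB; rewrite !inE => /orP[xA|xB].
  exists [set x; snd_end K (sigma (medge K x))]; apply/setP => g; rewrite !inE.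
  apply/andP/eqP => [[/imsetP[e _ ->]]|->].
    rewrite !inE snd_ne // orbF => /eqP xE.
    by rewrite xE medge_fst.
  rewrite !inE eqxx; split=> //; apply/imsetP; exists (medge K x) => //.
  by rewrite fst_medge.
(* A vertex of [B] is covered by the edge indexed by the preimage under [sigma] of its [M]-edge. *)
have [tau sK tK] := injF_bij ap.1.
exists [set fst_end K (tau (medge K x)); x]; apply/setP => g; rewrite !inE.
apply/andP/eqP => [[/imsetP[e _ ->]]|->].
  rewrite !inE fst_ne //= => /eqP xE.
  by rewrite xE medge_snd sK.
rewrite !inE eqxx orbT; split=> //; apply/imsetP.
by exists (tau (medge K x)); rewrite // tK snd_medge.
Qed.

Lemma matching_porosity_max M' X :
  perfect_matching M' -> #|M' :&: cut X| <= matching_porosity X.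
Proof.
exact: (@leq_bigmax_cond _ (@perfect_matching G) (fun M => #|M :&: cut X|)).
Qed.

Lemma cycle_porosity_trace X : perfect_matching M ->
  cycle_porosity (fst_end K @^-1: X : {set D}) <= 2 * matching_porosity X.
Proof.
move=> pmM; apply: cycle_porosity_leq => sigma ap.
set Y : {set D} := _ @^-1: _.
(* The factor 2 arises here: [S1] is bounded through [matching_of sigma] and [S2] through [M]. The
   [B]-end of [sigma e] cannot share a side of [X] with two [A]-ends that [X] separates. *)
pose S1 := [set e : D | (fst_end K e \in X) != (snd_end K (sigma e) \in X)].
pose S2 := [set e : D | (fst_end K (sigma e) \in X) != (snd_end K (sigma e) \in X)].
have sub : crossing sigma Y \subset S1 :|: S2.
  apply/subsetP => e; rewrite !inE.
  by case: (_ \in X); case: (_ \in X); case: (_ \in X).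
apply: leq_trans (subset_leq_card sub) _; apply: leq_trans (leq_card_setU _ _) _.
rewrite mul2n -addnn leq_add //.
  apply: leq_trans (matching_porosity_max _ (perfect_matching_of ap)).
  rewrite -(@card_in_imset _ _ (fun e => [set fst_end K e; snd_end K (sigma e)])).
    apply/subset_leq_card/subsetP => _ /imsetP[e eS ->].
    rewrite in_setI; apply/andP; split; first by apply/imsetP; exists e.
    by rewrite mem_cut ?arc_perm_edge //; rewrite inE in eS.
  move=> e f _ _ /setP/(_ (fst_end K e)); rewrite !inE eqxx /= => /esym/orP[]/eqP.
    exact: fst_inj.
  move=> ef; have [_ dAB _] := hAB; have := snd_endB K (sigma f).
  by rewrite -ef (disjointFr dAB) // fst_endA.
apply: leq_trans (matching_porosity_max _ pmM).
rewrite -(@card_imset _ _ (fun e => val (sigma e))); last first.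
  exact: inj_comp val_inj ap.1.
apply/subset_leq_card/subsetP => _ /imsetP[e eS ->].
rewrite inE (valP (sigma e)) (coords_val K) mem_cut ?coords_edge //.
by rewrite inE in eS.
Qed.

Section OtherMatching.
Variables (M' : {set {set G}}) (K' : coords A B M').

(** The permutation whose [matching_of] is [M']. *)
Definition perm_of (e : D) : D :=
  medge K (snd_end K' (medge K' (fst_end K e))).

Lemma arc_perm_of : arc_perm perm_of.
Proof.
have sndE e : snd_end K (perm_of e) = snd_end K' (medge K' (fst_end K e)).
  by apply: snd_medge; apply: snd_endB.
split=> [e f ef|e ne].
  have := congr1 (snd_end K) ef; rewrite !sndE.
  move/(can_inj (medge_snd K'))/(congr1 (fst_end K')).
  by rewrite !fst_medge ?fst_endA // => /fst_inj.
rewrite mdir_arcE eq_sym ne sndE /=.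
by rewrite -{1}[fst_end K e](fst_medge K') ?fst_endA ?coords_edge.
Qed.

(** The shore is a union of edges of [M], so an edge of [M'] that crosses it joins an [M]-edge
    inside [Y] to one outside, and [perm_of] moves the one at its [A]-end across [Y]. *)
Lemma cut_le_crossing Y :
  #|M' :&: cut [set x | medge K x \in Y]| <= #|crossing perm_of Y|.
Proof.
pose h (e : D) := val (medge K' (fst_end K e)).
apply: leq_trans (leq_imset_card h _); apply/subset_leq_card/subsetP => g.
case/setIP=> gM gC; pose g' : mdir_vertex M' := Sub g gM.
have gE : g = [set fst_end K' g'; snd_end K' g'] by rewrite -coords_val.
have fE : fst_end K (medge K (fst_end K' g')) = fst_end K' g'.
  by rewrite fst_medge ?fst_endA.
apply/imsetP; exists (medge K (fst_end K' g')).
  move: gC; rewrite gE mem_cut ?coords_edge // !inE.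
  by rewrite /perm_of fE medge_fst.
by rewrite /h fE medge_fst.
Qed.
End OtherMatching.

Lemma matching_porosity_preim Y :
  matching_porosity [set x | medge K x \in Y] <= cycle_porosity Y.
Proof.
apply/bigmax_leqP => M' /coords_ex[K'].
exact: leq_trans (cut_le_crossing K' Y) (crossing_le_porosity _ (arc_perm_of K')).
Qed.

(* If xy is an edge outside M, the symmetric difference of M with a perfect
   matching through xy contains an alternating cycle. *)
Lemma cycle_porosity_gt0 e f : matching_covered G -> e != f ->
  exists e', 0 < cycle_porosity [set e' : D].
Proof.
(* [S] holds the two ends of [e]. A path to [f] leaves it by an edge [xy] whose ends lie in
   different edges of [M]. *)
move=> [[_ con] cov] ef; pose S := [set x | medge K x == e].
have [x [y [xS yS xy]]] : exists x y, [/\ x \in S, y \notin S & x -- y].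
  have /connectP[p pp pE] := con (fst_end K e) (fst_end K f).
  have : last (fst_end K e) p \notin S by rewrite -pE inE medge_fst eq_sym.
  have : fst_end K e \in S by rewrite inE medge_fst.
  elim: p (fst_end K e) pp {pE} => [|y p IH] x /= => [_ ->//|/andP[xy pp] xS].
  have [yS|yS _] := boolP (y \in S); first exact: IH.
  by exists x, y.
rewrite !inE in xS yS.
have [M' pmM' xyM'] := cov _ (mem_edge_set xy).
have [K'] := coords_ex pmM'; pose sigma := perm_of K'.
(* If the [M]-edge at the [A]-end of [xy] were fixed, both ends of [xy] would lie in that edge. *)
have [e' ne] : exists e', sigma e' != e'.
  pose g' : mdir_vertex M' := Sub [set x; y] xyM'.
  exists (medge K (fst_end K' g')).
  rewrite /sigma /perm_of fst_medge ?fst_endA // medge_fst.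
  have : [set x; y] = [set fst_end K' g'; snd_end K' g'] by rewrite -coords_val.
  set a := fst_end K' g'; set b := snd_end K' g' => xyE.
  apply: contraNneq yS => ab.
  have xab : x \in [set a; b] by rewrite -xyE !inE eqxx.
  have yab : y \in [set a; b] by rewrite -xyE !inE eqxx orbT.
  by move: xab yab xS; rewrite !inE => /orP[]/eqP-> /orP[]/eqP->; rewrite ?ab.
exists e'; apply: leq_trans (crossing_le_porosity _ (arc_perm_of K')).
by apply/card_gt0P; exists e'; rewrite !inE eqxx.
Qed.

Lemma matching_porosity1 (x : G) : matching_porosity [set x] <= 1.
Proof.
apply/bigmax_leqP => M' /andP[_ /forallP/(_ x)/eqP <-].
apply/subset_leq_card/subsetP => g; rewrite !inE => /and3P[-> _].
by case/cards1P=> y /setP/(_ y); rewrite !inE eqxx => /andP[xg /eqP <-].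
Qed.

(** A leaf [e] becomes a node over the two ends of [e]. The new leaves are single vertices, of
    porosity at most 1, hence the bound on [k]. *)
Lemma tree_split_preim k Y : 0 < k ->
  tree_split (fun Y => cycle_porosity Y <= k) Y ->
  tree_split (fun X => matching_porosity X <= k) [set x | medge K x \in Y].
Proof.
have [covAB dAB _] := hAB => k0.
have le1 (x : G) : matching_porosity [set x] <= k.
  exact: leq_trans (matching_porosity1 x) k0.
elim=> [e he|{}Y Z bY IY bZ IZ dYZ hYZ].
  have pE : [set x | medge K x \in [set e]] = [set fst_end K e] :|: [set snd_end K e].
    apply/setP => x; rewrite !inE; apply/eqP/orP => [<-|[]/eqP->]; last 2 first.
    - exact: medge_fst.
    - exact: medge_snd.
    have /setP/(_ x) := covAB; rewrite !inE => /orP[xA|xB].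
      by left; rewrite fst_medge.
    by right; rewrite snd_medge.
  rewrite pE; apply: TreeNode; try exact: TreeLeaf.
    rewrite -setI_eq0; apply/eqP/setP => x; rewrite !inE.
    apply/andP => -[/eqP-> /eqP h]; have := snd_endB K e.
    by rewrite -h (disjointFr dAB) // fst_endA.
  by rewrite -pE; apply: leq_trans (matching_porosity_preim _) he.
have pE : [set x | medge K x \in Y :|: Z] =
    [set x | medge K x \in Y] :|: [set x | medge K x \in Z].
  by apply/setP => x; rewrite !inE.
rewrite pE; apply: TreeNode => //.
  rewrite -setI_eq0; apply/eqP/setP => x; rewrite !inE.
  by apply/andP => -[h]; rewrite (disjointFr dYZ h).
by rewrite -pE; apply: leq_trans (matching_porosity_preim _) hYZ.
Qed.

End Matching.
End Bipartite.

(** * The two inequalities *)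

Lemma porosity_shore_le (V : finType) (f : {set V} -> nat) (T : sgraph)
    (d : leaf_of T -> V) s t :
  s -- t -> f (shore d s t) <= width f d.
Proof.
move=> st; exact: (@leq_bigmax_cond _ (fun p : T * T => p.1 -- p.2)
  (fun p => f (shore d p.1 p.2)) (s, t)).
Qed.

Lemma cutC (G : sgraph) (X : {set G}) : cut (~: X) = cut X.
Proof.
apply/setP => g; rewrite 2!inE; have [/imsetP[[x y]]|//] := boolP (g \in _).
rewrite inE /= => xy ->; have := mem_cut (~: X) xy; have := mem_cut X xy.
rewrite 2!inE mem_edge_set //= !in_setC => -> ->.
by case: (x \in X); case: (y \in X).
Qed.

Lemma dcutC (D : digraph) (Y : {set D}) : dcut (~: Y) = dcut Y.
Proof.
by apply/setP => a; rewrite !inE; case: (_ \in Y); case: (_ \in Y).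
Qed.

Theorem theorem4p8 (G : sgraph) (A B : {set G}) (M : {set {set G}})
    (hAB : bipartition A B) (hG : matching_covered G)
    (hM : perfect_matching M)
    (p c : nat) (hp : is_pmw G p) (hc : is_cycw (mdirection A B M) c) :
  p <= c <= 2 * p.
Proof.
have [K] := coords_ex hAB hM.
case: hp => -[T [d [dd dp]]] minp; case: hc => -[S [f [ff fc]]] minc.
have [Y bY bY'] := @decomposition_tree_split _
  (fun Y => cycle_porosity Y <= c) _ _ ff
  (fun s t st => leq_trans (porosity_shore_le _ _ st) (eq_leq fc)).
have [X bX bX'] := @decomposition_tree_split _
  (fun X => matching_porosity X <= p) _ _ dd
  (fun s t st => leq_trans (porosity_shore_le _ _ st) (eq_leq dp)).
have /set0Pn[e eY] := tree_split_neq0 bY.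
have /set0Pn[e' eY'] := tree_split_neq0 bY'.
have ne : e != e' by apply: contraTneq eY => ->; rewrite inE in eY'.
apply/andP; split.
  (* Some singleton has positive cycle porosity, and it is a leaf set of the binary tree, so its
     porosity is at most [c]. *)
  have c0 : 0 < c.
    have [g] := cycle_porosity_gt0 hAB K hG ne; move/leq_trans; apply.
    have [gY|gY] := boolP (g \in Y); first exact: tree_split_leaf bY gY.
    by apply: tree_split_leaf bY' _; rewrite inE.
  have pC : [set x | medge K x \in ~: Y] = ~: [set x | medge K x \in Y].
    by apply/setP => x; rewrite !inE.
  have [||T' [d' [dd' le]]] := tree_split_decomposition _
      (tree_split_preim hAB K c0 bY).
  - by move=> Z; rewrite /matching_porosity cutC.
  - by rewrite -pC; apply: tree_split_preim.
  by apply: leq_trans (minp _ _ dd') _; apply/bigmax_leqP => -[s t]; apply: le.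
pose P (Z : {set mdirection A B M}) := cycle_porosity Z <= 2 * p.
have trace X' : tree_split (fun X => matching_porosity X <= p) X' ->
    fst_end K @^-1: X' = set0 \/ tree_split P (fst_end K @^-1: X').
  apply: tree_split_preimset; first exact: fst_inj.
  move=> Z hZ; apply: leq_trans (cycle_porosity_trace hAB K _ hM) _.
  by rewrite leq_mul2l.
(* If [X] or its complement contains no vertex of [A], the other one traces to all of [D], and the
   resulting tree is cut at its root instead; this uses the two vertices [e] and [e']. *)
have [Z bZ bZ'] : exists2 Z, tree_split P Z & tree_split P (~: Z).
  have D1 : 1 < #|{: mdirection A B M}|.
    by rewrite (cardD1 e) (cardD1 e') !inE eq_sym ne.
  have [e0|bZ] := trace _ bX; have [e0'|bZ'] := trace _ bX'.
  - by move/setP/(_ e): e0; move/setP/(_ e): e0'; rewrite !inE => /negbFE ->.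
  - by apply: tree_split_root D1; rewrite preimsetC e0 setC0 in bZ'.
  - apply: tree_split_root D1; move: bZ.
    by rewrite -[_ @^-1: X]setCK -preimsetC e0' setC0.
  - by exists (fst_end K @^-1: X); rewrite // -preimsetC.
have [|T' [d' [dd' le]]] := tree_split_decomposition _ bZ bZ'.
  by move=> U; rewrite /P /cycle_porosity dcutC.
by apply: leq_trans (minc _ _ dd') _; apply/bigmax_leqP => -[s t]; apply: le.
Qed.
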